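(* Let $u,v\in S_n$. Every shortest directed path from $u$ to $v$ in the quantum Bruhat graph $\Gamma_n$ has weight $q^{d(u,v)}=q_1^{d_1(u,v)}\cdots q_{n-1}^{d_{n-1}(u,v)}$, where $d_k(u,v)=\mathrm{depth}(u[k],v[k])$ for $k=1,\dots,n-1$.
   Context: Permutations $w\in S_n$ are written in one-line notation $w_1w_2\cdots w_n$ with $w_i=w(i)$; $\ell(w)$ is the number of inversions of $w$; $t_{ij}=(i\ j)$ is a transposition, and $wt_{ij}$ is obtained from $w$ by swapping the values in positions $i$ and $j$. For $w\in S_n$ and $1\le k\le n-1$, $w[k]:=\{w_1,\dots,w_k\}$. The quantum Bruhat graph $\Gamma_n$ is the weighted directed graph on vertex set $S_n$ with the following edges, for $1\le i<j\le n$: $w\to wt_{ij}$ of weight $1$ if $\ell(wt_{ij})=\ell(w)+1$; and $w\to wt_{ij}$ of weight $q_{ij}:=q_iq_{i+1}\cdots q_{j-1}$ if $\ell(wt_{ij})=\ell(w)+1-2(j-i)$. Here $q_1,\dots,q_{n-1}$ are indeterminates. The length of a directed path is its number of edges and its weight is the product of the weights of its edges. A shortest path from $u$ to $v$ is a directed path from $u$ to $v$ of minimal length. For $A,B\subset[n]=\{1,\dots,n\}$ with $|A|=|B|$, the lattice path $P(A,B)$ from $(0,0)$ to $(n,0)$ has $n$ steps, whose $i$-th step is $(1,1)$ if $i\in A$, $i\notin B$; $(1,-1)$ if $i\notin A$, $i\in B$; and $(1,0)$ if $i\in A\cap B$ or $i\notin A\cup B$. The depth $\mathrm{depth}(A,B)$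 is the largest number $y\ge 0$ such that $P(A,B)$ passes through $(x,-y)$ for some $x$. *)

(* Defs.v *)
From mathcomp Require Import all_boot all_order all_algebra all_fingroup.
From mathcomp Require Export mpoly.

Set Implicit Arguments.
Unset Strict Implicit.
Unset Printing Implicit Defensive.

Import GRing.Theory.

Local Open Scope ring_scope.

(* 'S_n acts on 'I_n = {0, ..., n-1}, so positions and values are those of
   [n] = {1, ..., n} shifted down by one.  The indeterminates q_1, ..., q_(n-1)
   are shifted likewise: q_k is 'X_(k-1) in {mpoly int[n.-1]}. *)

Definition inversions n (w : 'S_n) : {set 'I_n * 'I_n} :=
  [set p : 'I_n * 'I_n | (p.1 < p.2)%N && (w p.2 < w p.1)%N].

Definition perm_length n (w : 'S_n) : nat := #|inversions w|.

(* Products of permutations in MathComp apply the left factor first, so that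
   (tperm i j * w) x = w (tperm i j x): this is w t_ij, in which the values at
   positions i and j are swapped. *)
Definition swap_positions n (w : 'S_n) (i j : 'I_n) : 'S_n :=
  (tperm i j * w)%g.

(* With positions counted from 0, q_ij is the product of the 'X_k for
   i <= k < j. *)
Definition q_interval n (i j : 'I_n) : {mpoly int[n.-1]} :=
  \prod_(k < n.-1 | (i <= k < j)%N) 'X_k.

(* qbg_edge w w' a: the quantum Bruhat graph has an edge w -> w' of weight a *)
Inductive qbg_edge n (w : 'S_n) : 'S_n -> {mpoly int[n.-1]} -> Prop :=
| QbgUp (i j : 'I_n) of (i < j)%N &
    (perm_length (swap_positions w i j))%:Z = (perm_length w)%:Z + 1 :
    qbg_edge w (swap_positions w i j) 1
| QbgDown (i j : 'I_n) of (i < j)%N &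
    (perm_length (swap_positions w i j))%:Z
      = (perm_length w)%:Z + 1 - 2 * (j%:Z - i%:Z) :
    qbg_edge w (swap_positions w i j) (q_interval i j).

(* A directed path is given by the sequence of its edges, each recorded as its
   target vertex together with its weight. *)
Fixpoint is_qbg_path n (u : 'S_n) (s : seq ('S_n * {mpoly int[n.-1]}))
    (v : 'S_n) : Prop :=
  if s is (w, a) :: s' then qbg_edge u w a /\ is_qbg_path w s' v else u = v.

Definition path_weight n (s : seq ('S_n * {mpoly int[n.-1]})) :
    {mpoly int[n.-1]} :=
  \prod_(e <- s) e.2.

Definition is_shortest_path n (u : 'S_n) (s : seq ('S_n * {mpoly int[n.-1]}))
    (v : 'S_n) : Prop :=
  is_qbg_path u s v /\
  forall s', is_qbg_path u s' v -> (size s <= size s')%N.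

Definition lattice_step n (A B : {set 'I_n}) (i : 'I_n) : int :=
  if (i \in A) && (i \notin B) then 1
  else if (i \notin A) && (i \in B) then -1
  else 0.

(* ordinate of the lattice path P(A, B) at abscissa x *)
Definition lattice_height n (A B : {set 'I_n}) (x : nat) : int :=
  \sum_(i < n | (i < x)%N) lattice_step A B i.

(* P(A, B) has n steps, so its ordinates are at least -n, and y may be
   restricted to 0 <= y <= n. *)
Definition depth n (A B : {set 'I_n}) : nat :=
  \max_(y < n.+1 | [exists x : 'I_n.+1, lattice_height A B x == - y%:Z]) y.

(* w[k], the set of the first k values of w *)
Definition first_values n (w : 'S_n) (k : nat) : {set 'I_n} :=
  [set w i | i : 'I_n & (i < k)%N].

Definition depth_at n (k : nat) (u v : 'S_n) : nat :=
  depth (first_values u k) (first_values v k).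

(* Main.v *)
Require Import Defs.
From mathcomp Require Import all_boot all_order all_algebra all_fingroup mpoly.
From mathcomp Require Import zify.

Import GRing.Theory.

Local Open Scope ring_scope.

(** Give the edge [w -> w'] the multidegree of its weight: [0] for an edge that
    raises the length, the indicator of the interval from [i] to [j] for a
    quantum edge.  In both cases [l(w') + 2 |m| = l(w) + 1], so along a path
    from [u] to [v] of total multidegree [m] the number of edges is
    [l(v) - l(u) + 2 |m|].  A shortest path is therefore one whose weight has
    least total degree, and the theorem follows from two facts about the vector
    [d(u, v)] of depths:

    - [m >= d(u, v)] in every coordinate, for every path ([qbg_path_mnm]).
      Depths satisfy the triangle inequality, so this need only be checked on a
      single edge, where [w[k]] changes by at most one element: its depth is
      at most one, and is zero if that element is replaced by a larger one.

    - Some path has [m = d(u, v)] ([exists_path_of_depth_weight]).  It is built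
      greedily.  Let [i] be the first position where [u] and [v] differ, and
      walk around the cycle of values from [u i] to [v i]; let [j] be the first
      position after [i] whose value is met on this walk.  Swapping positions
      [i] and [j] is an edge ([greedy_pair_edge]), upward if
      [u i < u j] and quantum otherwise, and it lowers the depths by exactly
      its own multidegree ([greedy_pair_depth]), because for [i < k <= j] the
      lattice path of [u[k]] against [v[k]] cannot be at its lowest on the part
      of the cycle between [u i] and [u j] ([greedy_pair_descent]).

    A shortest path then has [m >= d(u, v)] and [|m| <= |d(u, v)|], whence
    [m = d(u, v)]. *)

(** * Depth as a difference of counts *)

(** Lattice paths are handled through these counts: the ordinate at [x] of the
    path of [u[k]] against [v[k]] is the count for [u] minus that for [v]. *)
Definition count_below {n} (w : 'S_n) (k x : nat) : nat :=
  (\sum_(p < n | p < k) (w p < x))%N.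

Lemma count_belowE n (w : 'S_n) (k x : nat) :
  (\sum_(y < n | (y < x)%N) (y \in first_values w k))%N = count_below w k x.
Proof.
rewrite (reindex_inj (@perm_inj _ w)) /count_below big_mkcond [RHS]big_mkcond.
apply: eq_bigr => p _ /=.
have -> : (w p \in first_values w k) = (p < k)%N.
  apply/imsetP/idP => [[p' p'k e]|pk]; last first.
    by exists p; rewrite ?inE.
  by move: p'k; rewrite (perm_inj e) inE.
by case: ifP; case: ifP.
Qed.

Lemma lattice_height_first_values n (u v : 'S_n) (k x : nat) :
  lattice_height (first_values u k) (first_values v k) x =
  (count_below u k x)%:Z - (count_below v k x)%:Z.
Proof.
rewrite -!count_belowE !(big_morph Posz PoszD (erefl (Posz 0))) -sumrB.
apply: eq_bigr => y _; rewrite /lattice_step.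
by do 2!case: (y \in _).
Qed.

Lemma count_below_0 n (w : 'S_n) (k : nat) : count_below w k 0 = 0%N.
Proof. by rewrite /count_below big1. Qed.

Lemma count_below_le n (w : 'S_n) (k x : nat) : (count_below w k x <= n)%N.
Proof.
rewrite -[leqRHS]card_ord -sum1_card /count_below big_mkcond.
by apply: leq_sum => p _; case: ifP => // _; case: (w p < x)%N.
Qed.

(** This and the next lemma characterise the depth as a maximum over abscissae
    of differences of counts, written additively to stay in [nat]. *)
Lemma depth_at_ub n (k x : nat) (u v : 'S_n) : (x <= n)%N ->
  (count_below v k x <= count_below u k x + depth_at k u v)%N.
Proof.
move=> xn; rewrite -leq_subLR.
set y := (count_below v k x - count_below u k x)%N.
have [->//|y0] := posnP y.
have yn : (y < n.+1)%N.
  by rewrite ltnS (leq_trans (leq_subr _ _)) ?count_below_le.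
apply: (@leq_bigmax_cond _ _ (fun y : 'I_n.+1 => y : nat) (Ordinal yn)).
apply/existsP; exists (Ordinal (xn : x < n.+1)%N).
by rewrite lattice_height_first_values /=; lia.
Qed.

Lemma depth_at_attained n (k : nat) (u v : 'S_n) : exists2 x, (x <= n)%N &
  (count_below v k x = count_below u k x + depth_at k u v)%N.
Proof.
pose P (y : 'I_n.+1) := [exists x : 'I_n.+1,
  lattice_height (first_values u k) (first_values v k) x == - (y : nat)%:Z].
have P0 : P ord0.
  apply/existsP; exists ord0.
  by rewrite lattice_height_first_values !count_below_0 oppr0 subrr.
have [y Py ->] : {y : 'I_n.+1 | P y & depth_at k u v = y}.
  by apply: eq_bigmax_cond; apply/card_gt0P; exists ord0.
have /existsP[x] := Py; rewrite lattice_height_first_values => /eqP xy.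
by exists (x : nat); [rewrite -ltnS | lia].
Qed.

Lemma depth_at_triangle n (k : nat) (u v w : 'S_n) :
  (depth_at k u w <= depth_at k u v + depth_at k v w)%N.
Proof.
have [x xn] := depth_at_attained n k u w.
have := depth_at_ub n k x u v xn.
have := depth_at_ub n k x v w xn.
lia.
Qed.

Lemma depth_at_id n (k : nat) (u : 'S_n) : depth_at k u u = 0%N.
Proof. by have [x _] := depth_at_attained n k u u; lia. Qed.

(** * The effect of a swap *)

Lemma swap_positionsL n (w : 'S_n) i j : swap_positions w i j i = w j.
Proof. by rewrite permM tpermL. Qed.

Lemma swap_positionsR n (w : 'S_n) i j : swap_positions w i j j = w i.
Proof. by rewrite permM tpermR. Qed.

Lemma swap_positionsD n (w : 'S_n) i j p :
  p != i -> p != j -> swap_positions w i j p = w p.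
Proof. by move=> pi pj; rewrite permM tpermD // eq_sym. Qed.

Lemma swap_positionsK n (w : 'S_n) i j :
  swap_positions (swap_positions w i j) i j = w.
Proof. by rewrite /swap_positions mulgA tperm2 mul1g. Qed.

Lemma perm_lengthE n (w : 'S_n) :
  perm_length w = (\sum_(p < n) \sum_(q < n) ((p < q) && (w q < w p)))%N.
Proof.
rewrite pair_bigA /perm_length -sum1_card big_mkcond /=.
by apply: eq_bigr => -[p q] _; rewrite inE /=; case: (_ && _).
Qed.

(** Isolates the pairs that meet [i] or [j], the only ones whose inversion
    status can change under a swap of these two positions. *)
Lemma sum_pairs_split n (i j : 'I_n) (F : 'I_n -> 'I_n -> nat) : i != j ->
  (\sum_p \sum_q F p q = F i i + F i j + F j i + F j j
    + \sum_(r | (r != i) && (r != j)) (F i r + F r i + F j r + F r j)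
    + \sum_(p | (p != i) && (p != j)) \sum_(q | (q != i) && (q != j)) F p q)%N.
Proof.
move=> ij.
have split1 (G : 'I_n -> nat) :
    (\sum_p G p = G i + G j + \sum_(p | (p != i) && (p != j)) G p)%N.
  by rewrite (bigD1 i) // (bigD1 j) 1?eq_sym //= addnA.
rewrite split1 !(split1 (F _)) (eq_bigr _ (fun p _ => split1 (F p))).
rewrite !big_split /=.
set a := (\sum_(_ | _) F _ i)%N; set b := (\sum_(_ | _) F _ j)%N.
lia.
Qed.

(** The pair [(i, j)] becomes an inversion.  A third position [r] contributes
    through its two pairs with [i] and [j] together, and this contribution
    changes, by two, only if [r] lies between [i] and [j] in position and in
    value. *)
Lemma perm_length_swap n (w : 'S_n) (i j : 'I_n) : (i < j)%N -> (w i < w j)%N ->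
  perm_length (swap_positions w i j) =
  (perm_length w + 1 + 2 * \sum_(p < n) ((i < p < j) && (w i < w p < w j)))%N.
Proof.
move=> ij wij; have nij : i != j by rewrite -val_eqE /= neq_ltn ij.
rewrite !perm_lengthE !(sum_pairs_split n i j) //.
rewrite swap_positionsL swap_positionsR !ltnn ij wij /=.
rewrite [(j < i)%N]ltnNge [(w j < w i)%N]ltnNge (ltnW ij) (ltnW wij) /=.
set between := (\sum_(p < n) _)%N.
have -> : between = (\sum_(r | (r != i) && (r != j))
    ((i < r < j) && (w i < w r < w j)))%N.
  rewrite /between (bigID (fun r => (r != i) && (r != j))) /=.
  rewrite [X in (_ + X)%N]big1 ?addn0 // => r.
  by rewrite negb_and !negbK => /orP[] /eqP ->; rewrite !ltnn ?andbF.
set s' := swap_positions w i j.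
have -> : (\sum_(p | (p != i) && (p != j)) \sum_(q | (q != i) && (q != j))
      ((p < q) && (s' q < s' p)) =
    \sum_(p | (p != i) && (p != j)) \sum_(q | (q != i) && (q != j))
      ((p < q) && (w q < w p)))%N.
  apply: eq_bigr => p /andP[pi pj]; apply: eq_bigr => q /andP[qi qj].
  by rewrite /s' !swap_positionsD.
set star' := (\sum_(r | (r != i) && (r != j)) (_ + _ + _ + _))%N.
set star := (\sum_(r | (r != i) && (r != j)) (_ + _ + _ + _))%N.
set mid := (\sum_(r | (r != i) && (r != j)) ((i < r < j) && _))%N.
have -> : star' = (star + 2 * mid)%N.
  rewrite /star' /star /mid big_distrr /= -big_split /=.
  apply: eq_bigr => r /andP[ri rj].
  rewrite /s' swap_positionsD //.
  have wri : (w r : nat) <> w i.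
    by move=> /val_inj/perm_inj e; rewrite e eqxx in ri.
  have wrj : (w r : nat) <> w j.
    by move=> /val_inj/perm_inj e; rewrite e eqxx in rj.
  move: ri rj; rewrite -!val_eqE /= => ri rj.
  lia.
move: (\sum_(p | _) _)%N => rest.
by clearbody star mid; lia.
Qed.

(** The correcting terms are put on opposite sides so that no subtraction
    occurs; they vanish unless exactly one of the two positions is below
    [k]. *)
Lemma count_below_swap n (w : 'S_n) (i j : 'I_n) (k x : nat) : (i < j)%N ->
  (count_below (swap_positions w i j) k x + ((i < k <= j) && (w i < x)) =
   count_below w k x + ((i < k <= j) && (w j < x)))%N.
Proof.
move=> ij; rewrite /count_below; have [ik|ki] := ltnP i k; last first.
  congr addn; apply: eq_bigr => p pk.
  by rewrite swap_positionsD // -val_eqE /=; lia.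
have [kj|jk] := leqP k j.
  rewrite (bigD1 i) // [in RHS](bigD1 i) //= swap_positionsL.
  rewrite (eq_bigr (fun p => (w p < x)%N : nat)); first last.
  move=> p /andP[pk pi].
  by rewrite swap_positionsD // -val_eqE /=; lia.
  by rewrite addnC addnA [RHS]addnAC.
congr addn.
rewrite (reindex_inj (@perm_inj _ (tperm i j))) /=.
apply: eq_big => [p|p _]; first by case: tpermP => [->|->|//]; rewrite ik jk.
by rewrite permM tpermK.
Qed.

(** * Multidegrees of edges and paths *)

Definition interval_mnm {n} (i j : 'I_n) : 'X_{1..n.-1} :=
  [multinom ((i <= k < j) : nat)%N | k < n.-1].

Definition depth_mnm {n} (u v : 'S_n) : 'X_{1..n.-1} :=
  [multinom depth_at k.+1 u v | k < n.-1].

Lemma q_intervalE n (i j : 'I_n) : q_interval i j = 'X_[interval_mnm i j].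
Proof.
rewrite mpolyXE_id /q_interval big_mkcond; apply: eq_bigr => k _.
by rewrite mnmE; case: (_ <= _ < _)%N; rewrite ?expr1 ?expr0.
Qed.

Lemma sum_interval (m i j : nat) :
  (\sum_(k < m) (i <= k < j) = minn j m - i)%N.
Proof.
by elim: m => [|m IHm]; rewrite ?big_ord0 ?big_ord_recr /= ?IHm; lia.
Qed.

Lemma mdeg_interval n (i j : 'I_n) : mdeg (interval_mnm i j) = (j - i)%N.
Proof.
rewrite mdegE (eq_bigr (fun k : 'I_n.-1 => ((i <= k < j) : nat)%N)).
  by rewrite sum_interval; have := ltn_ord j; lia.
by move=> k _; rewrite mnmE.
Qed.

Lemma mpolyX_inj n (m1 m2 : 'X_{1..n}) :
  'X_[m1] = 'X_[m2] :> {mpoly int[n]} -> m1 = m2.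
Proof.
move=> /(congr1 (mcoeff m1)); rewrite !mcoeffX eqxx.
by case: (eqVneq m2 m1).
Qed.

Lemma depth_mnm_triangle n (u v w : 'S_n) :
  (depth_mnm u w <= depth_mnm u v + depth_mnm v w)%MM.
Proof. by apply/mnm_lepP => k; rewrite mnmDE !mnmE depth_at_triangle. Qed.

Lemma depth_mnm_id n (u : 'S_n) : depth_mnm u u = 0%MM.
Proof. by apply/mnmP => k; rewrite !mnmE depth_at_id. Qed.

(** Otherwise the length formula, applied to the swapped permutation, would say
    that the swap lowers the length. *)
Lemma ascent_of_perm_length_swap n (w : 'S_n) (i j : 'I_n) : (i < j)%N ->
  (perm_length w < perm_length (swap_positions w i j))%N -> (w i < w j)%N.
Proof.
move=> ij; case: (ltngtP (w i) (w j)) => // [wji|/val_inj/perm_inj wij].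
  have := perm_length_swap n (swap_positions w i j) i j ij.
  by rewrite swap_positionsK swap_positionsL swap_positionsR => /(_ wji); lia.
by rewrite wij ltnn in ij.
Qed.

(** For a quantum edge the depth bound uses only that the first [k] values
    change by at most one element, and not at all unless [i < k <= j]; for an
    upward edge it uses that the new element is the larger one. *)
Lemma qbg_edge_mnm n (w w' : 'S_n) (a : {mpoly int[n.-1]}) :
  qbg_edge w w' a -> exists m : 'X_{1..n.-1},
    [/\ a = 'X_[m],
        (perm_length w' + 2 * mdeg m = perm_length w + 1)%N
      & (depth_mnm w w' <= m)%MM].
Proof.
case=> i j ij len.
  exists 0%MM; rewrite mpolyX0 mdeg0; split=> //; first by lia.
  have wij : (w i < w j)%N.
    by apply: ascent_of_perm_length_swap => //; lia.
  apply/mnm_lepP => k; rewrite !mnmE.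
  have [x xn] := depth_at_attained n k.+1 w (swap_positions w i j).
  have := count_below_swap n w i j k.+1 x ij; lia.
exists (interval_mnm i j); rewrite q_intervalE mdeg_interval; split=> //.
  by lia.
apply/mnm_lepP => k; rewrite !mnmE.
have [x xn] := depth_at_attained n k.+1 w (swap_positions w i j).
have := count_below_swap n w i j k.+1 x ij; lia.
Qed.

(** The length identity turns shortest into least total degree, and the last
    part bounds the multidegree of every path from below. *)
Lemma qbg_path_mnm n (u v : 'S_n) (s : seq ('S_n * {mpoly int[n.-1]})) :
  is_qbg_path u s v -> exists m : 'X_{1..n.-1},
    [/\ path_weight s = 'X_[m],
        (perm_length v + 2 * mdeg m = perm_length u + size s)%N
      & (depth_mnm u v <= m)%MM].
Proof.
elim: s u => [|[w a] s IHs] u /= => [->|[/qbg_edge_mnm[m1 [-> len1 dep1]]]].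
  exists 0%MM; rewrite /path_weight big_nil mpolyX0 mdeg0 depth_mnm_id.
  by split=> //; rewrite ?lepm_refl //; lia.
move=> /IHs[m2 [wt2 len2 dep2]]; exists (m1 + m2)%MM; split.
- by rewrite /path_weight big_cons /= mpolyXD -wt2.
- by rewrite mdegD; lia.
apply: (lepm_trans (depth_mnm_triangle n u w v)).
apply/mnm_lepP => k; rewrite !mnmDE.
by apply: leq_add; apply/mnm_lepP.
Qed.

(** * The greedy path *)

Lemma exists_first n (P : pred 'I_n) (x : 'I_n) : P x ->
  exists2 i, P i & forall j : 'I_n, (j < i)%N -> ~~ P j.
Proof.
move=> Px; case: (arg_minnP (fun i : 'I_n => i : nat) Px) => i Pi imin.
by exists i => // j; apply: contraL => /imin; rewrite -leqNgt.
Qed.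

(** Membership in the interval from [a] (excluded) to [b] (included) in the
    cyclic order of the values; the second disjunct is the interval that wraps
    around past the largest value, the whole cycle if [a = b].  It serves for
    abscissae as well, the values below [x] being those that precede
    abscissa [x]. *)
Definition cyclic_itv (a b x : nat) : bool :=
  ((a < x <= b) || ((b <= a) && ((a < x) || (x <= b))))%N.

(** The first position at which [u] and [v] differ, and the first later
    position whose [u]-value lies on the way from [u i] to [v i] around the
    cycle of values. *)
Definition greedy_pair {n} (u v : 'S_n) (i j : 'I_n) : Prop :=
  [/\ [/\ u i != v i & forall p : 'I_n, (p < i)%N -> u p = v p],
      (i < j)%N, cyclic_itv (u i) (v i) (u j)
    & forall p : 'I_n, (i < p < j)%N -> ~~ cyclic_itv (u i) (v i) (u p)].

(** The value [v i] itself sits in [u] at a position beyond [i], because [u]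
    and [v] agree before [i]; so there are candidates for [j]. *)
Lemma exists_greedy_pair n (u v : 'S_n) :
  u != v -> exists i j, greedy_pair u v i j.
Proof.
move=> uv.
have [i0 ui0] : exists i, u i != v i.
  apply/existsP; apply: contraNT uv; rewrite negb_exists => /forallP e.
  by apply/eqP/permP => i; apply/eqP/negPn.
have [i ui imin] := exists_first n (fun i => u i != v i) i0 ui0.
have {}imin (p : 'I_n) : (p < i)%N -> u p = v p by move=> /imin/negPn/eqP.
pose P (j : 'I_n) := (i < j)%N && cyclic_itv (u i) (v i) (u j).
have [j0 uj0] : exists j, u j = v i by exists (u^-1 (v i))%g; rewrite permKV.
have ij0 : (i < j0)%N.
  case: (ltngtP i j0) => // [ji|/val_inj e].
    by move: (imin _ ji); rewrite uj0 => /perm_inj e; rewrite e ltnn in ji.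
  by move: ui; rewrite -uj0 -e eqxx.
have nuv : (u i : nat) <> v i by move=> /val_inj e; rewrite e eqxx in ui.
have Pj0 : P j0 by rewrite /P ij0 uj0 /cyclic_itv; lia.
have [j /andP[ij cj] jmin] := exists_first n P j0 Pj0.
exists i, j; split=> // p /andP[ip pj].
by have := jmin p pj; rewrite /P ip.
Qed.

Definition greedy_mnm {n} (u : 'S_n) (i j : 'I_n) : 'X_{1..n.-1} :=
  if (u i < u j)%N then 0%MM else interval_mnm i j.

(** The values strictly between positions [i] and [j] avoid the cyclic
    interval from [u i] to [v i], hence the shorter one from [u i] to [u j].
    If [u i < u j], none of them lies between the two swapped values, so the
    length goes up by one.  If [u j < u i], the cyclic interval wraps around
    and its complement is the range of values between [u j] and [u i]: all of
    them lie there, so the length drops by the full [2 (j - i) - 1]. *)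
Lemma greedy_pair_edge n (u v : 'S_n) (i j : 'I_n) : greedy_pair u v i j ->
  qbg_edge u (swap_positions u i j) 'X_[greedy_mnm u i j].
Proof.
move=> [_ ij cj jmin].
have nup (p : 'I_n) : (i < p)%N -> (u p : nat) <> u i.
  by move=> ip /val_inj/perm_inj e; rewrite e ltnn in ip.
rewrite /greedy_mnm; case: ltnP => uij.
  rewrite mpolyX0; apply: QbgUp => //.
  rewrite perm_length_swap // big1 ?muln0 ?addn0 // => p _.
  apply/eqP; rewrite eqb0; apply/negP => /andP[ipj].
  by have := jmin p ipj; move: cj; rewrite /cyclic_itv; lia.
rewrite -q_intervalE; apply: QbgDown => //.
set w := swap_positions u i j.
(* the length formula, read from the shorter permutation w up to u *)
have := perm_length_swap n w i j ij.
rewrite swap_positionsK swap_positionsL swap_positionsR.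
have -> : (\sum_(p < n) ((i < p < j) && (u j < w p < u i)) = j - i.+1)%N.
  have := sum_interval n i.+1 j; rewrite (minn_idPl (ltnW (ltn_ord j))) => <-.
  apply: eq_bigr => p _; congr nat_of_bool.
  case: (boolP (i < p < j)%N) => //= ipj; have /andP[ip pj] := ipj.
  rewrite swap_positionsD.
  - have := jmin p ipj; have := nup p ip.
    by move: cj; rewrite /cyclic_itv; lia.
  - by rewrite -val_eqE /= neq_ltn ip orbT.
  - by rewrite -val_eqE /= neq_ltn pj.
have uji : (u j < u i)%N by have := nup j ij; lia.
by move=> /(_ uji); rewrite -/w; lia.
Qed.

(** Going from abscissa [x] forward around the cycle to [v i + 1], the path of
    [u] against [v] falls by at least one: every value of [u] met on the way
    at a position below [k] sits before [i], where [v] takes the same value,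
    while [v] also meets [v i] at position [i].  Moving the [x] terms across
    gives an inequality that holds position by position, whether or not the
    cyclic interval wraps around. *)
Lemma greedy_pair_descent n (u v : 'S_n) (i j : 'I_n) (k x : nat) :
  greedy_pair u v i j -> (i < k <= j)%N -> cyclic_itv (u i) (u j) x ->
  (count_below u k (v i).+1 + count_below v k x + 1 <=
   count_below v k (v i).+1 + count_below u k x)%N.
Proof.
move=> [[ui imin] ij cj jmin] /andP[ik kj] cx.
have nuv : (u i : nat) <> v i by move=> /val_inj e; rewrite e eqxx in ui.
(* the extra 1 is charged to position i *)
have -> : (1 = \sum_(p < n | p < k) (p == i))%N.
  by rewrite (bigD1 i) //= eqxx big1 // => p /andP[_ /negbTE ->].
rewrite /count_below -!big_split /=; apply: leq_sum => p pk.
case: (ltngtP p i) => [pi|ip|/val_inj ->].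
- by rewrite imin // -val_eqE /= ltn_eqF // addn0.
- have ipj : (i < p < j)%N by rewrite ip (leq_trans pk kj).
  have nup : (u p : nat) <> u i.
    by move=> /val_inj/perm_inj e; rewrite e ltnn in ip.
  have := jmin p ipj.
  by rewrite -val_eqE /= gtn_eqF //; move: cx cj; rewrite /cyclic_itv; lia.
- by move: cx cj; rewrite eqxx /cyclic_itv; lia.
Qed.

(** The triangle inequality leaves only one direction to prove.  At an
    abscissa where the depth from the new vertex to [v] is attained, the old
    lattice path is already low enough, except for abscissae in the cyclic
    interval from [u i] to [u j]; there the old path descends further by the
    previous lemma, which supplies the missing unit. *)
Lemma greedy_pair_depth n (u v : 'S_n) (i j : 'I_n) : greedy_pair u v i j ->
  depth_mnm u v =
  (greedy_mnm u i j + depth_mnm (swap_positions u i j) v)%MM.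
Proof.
move=> gp; have edge := greedy_pair_edge n u v i j gp.
have ij : (i < j)%N by case: gp.
have nuij : (u i : nat) <> u j.
  by move=> /val_inj/perm_inj e; rewrite e ltnn in ij.
set w := swap_positions u i j in edge *.
apply/mnmP => k; apply/eqP; rewrite eqn_leq; apply/andP; split.
  have [m [/mpolyX_inj e _ dep]] := qbg_edge_mnm n u w _ edge.
  apply: (leq_trans (mnm_lepP (depth_mnm_triangle n u w v) k)).
  by rewrite !mnmDE leq_add2r e; apply/mnm_lepP.
rewrite mnmDE !mnmE.
have -> : greedy_mnm u i j k = (~~ (u i < u j) && (i <= k < j))%N.
  by rewrite /greedy_mnm; case: ltnP; rewrite mnmE.
have [x xn atx] := depth_at_attained n k.+1 w v.
have := count_below_swap n u i j k.+1 x ij; rewrite -/w.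
have := depth_at_ub n k.+1 x u v xn.
case: (boolP ((i < k.+1 <= j) && cyclic_itv (u i) (u j) x)%N); last first.
  by rewrite /cyclic_itv; lia.
move=> /andP[ikj cx] ubx swx.
have ubv := depth_at_ub n k.+1 (v i).+1 u v (ltn_ord (v i)).
have desc := greedy_pair_descent n u v i j k.+1 x gp ikj cx.
by move: cx swx; rewrite /cyclic_itv; lia.
Qed.

(** Each greedy edge lowers by one the length that the identity of
    [qbg_path_mnm] predicts for the rest of the path; [n * n], which bounds
    [l(u)], replaces [l(v)] to make this predicted length visibly a natural
    number. *)
Lemma exists_path_of_depth_weight n (u v : 'S_n) :
  exists2 s, is_qbg_path u s v & path_weight s = 'X_[depth_mnm u v].
Proof.
have [N] := ubnP ((n * n - perm_length u) + 2 * mdeg (depth_mnm u v))%N.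
elim: N u => // N IHN u leN.
have [->|/exists_greedy_pair[i [j gp]]] := eqVneq u v.
  by exists [::]; rewrite //= depth_mnm_id mpolyX0 /path_weight big_nil.
have edge := greedy_pair_edge n u v i j gp.
have dep := greedy_pair_depth n u v i j gp.
move: edge dep; set w := swap_positions u i j; set m := greedy_mnm u i j.
move=> edge dep.
have [m' [/mpolyX_inj e len _]] := qbg_edge_mnm n u w _ edge; subst m'.
have lenw : (perm_length w <= n * n)%N.
  by rewrite (leq_trans (max_card _)) // card_prod card_ord.
have [|s ws wt] := IHN w; first by move: leN; rewrite dep mdegD; lia.
exists ((w, 'X_[m]) :: s) => //.
by rewrite /path_weight big_cons /= -/(path_weight s) wt dep mpolyXD.
Qed.

Theorem theorem3p3 (n : nat) (u v : 'S_n)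
    (s : seq ('S_n * {mpoly int[n.-1]})) (hs : is_shortest_path u s v) :
  path_weight s = \prod_(k < n.-1) 'X_k ^+ depth_at k.+1 u v.
Proof.
have [/qbg_path_mnm[m [-> len dep]] short] := hs.
have [s' us'v wt'] := exists_path_of_depth_weight n u v.
have [m' [wt'' len' _]] := qbg_path_mnm n u v s' us'v.
have e : m' = depth_mnm u v by apply: mpolyX_inj; rewrite -wt'' wt'.
have deg : (mdeg m <= mdeg (depth_mnm u v))%N.
  by have := short _ us'v; rewrite -e; lia.
have -> : m = depth_mnm u v.
  have := submK dep; move: deg => /[swap] <-.
  rewrite mdegD -[leqRHS]add0n leq_add2r leqn0 mdeg_eq0 => /eqP ->.
  by rewrite add0m.
by rewrite mpolyXE_id; apply: eq_bigr => k _; rewrite mnmE.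
Qed.
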